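(* Assume the Hardy--Littlewood conjecture (HL). Let $D\in\{2,3,7,11,19,43,67,163\}$, $r\in\mathbb{Z}\setminus\{0\}$, and let $q\geqslant1$ and $a$ be integers with $\gcd(q,a)=1$. Then as $x\to+\infty$: if $D=2$, $$\Pi_D(x;r,q,a)\sim\theta(D,r)\,\varrho(r,q,a)\cdot\frac{2\sqrt2}{q}\,\frac{q^\sharp}{\varphi(q^\sharp)}\prod_{p\nmid2qr}\Big(1-\frac{(\frac{-2}{p})}{p-1}\Big)\cdot\frac{\sqrt x}{\log x};$$ if $D>2$, $$\Pi_D(x;r,q,a)\sim\theta(D,r)\,\varrho_D(r,q,a)\cdot\frac{2\gcd(2,q(r+1))}{q}\,\frac{\sqrt D\,q^\sharp}{\varphi(Dq^\sharp)}\prod_{p\nmid2qr}\Big(1-\frac{(\frac{-D}{p})}{p-1}\Big)\cdot\frac{\sqrt x}{\log x}.$$ Here $q^\sharp$ is the odd part of $q$, and $$\varrho(r,q,a)=\Big|\Big\{t\ \mathrm{mod}\ q:\ 2t^2+\tfrac{r^2}{4}\equiv a\ (\mathrm{mod}\ q)\Big\}\Big|,\qquad\varrho_D(r,q,a)=\Big|\Big\{t\ \mathrm{mod}\ q:\ Dt^2-Drt+\tfrac{D+1}{4}r^2\equiv a\ (\mathrm{mod}\ q)\Big\}\Big|.$$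
   Context: Let $R_D$ be the ring of integers of $\mathbb{Q}(\sqrt{-D})$, $\Pi_D(x)$ the set of $\pi\in R_D$ whose norm $N(\pi)=\pi\bar\pi$ is a rational prime $\leqslant x$, and $$\Pi_D(x;r,q,a)=|\{\pi\in\Pi_D(x):\ \mathrm{Tr}(\pi)=r,\ N(\pi)\equiv a\ (\mathrm{mod}\ q)\}|.$$ $\theta(D,r)=1$ if [$D=2$ and $r\equiv2$ mod $4$], or [$D\equiv3$ mod $4$, $2\mid r$, $\gcd(D,r)=1$], or [$D\equiv3$ mod $8$, $2\nmid r$, $\gcd(D,r)=1$]; $\theta(D,r)=0$ otherwise. (When $\theta(D,r)=0$ the right side is read as $0$.) If the constant is $0$, the asymptotic formula means the left side is $O(1)$. Infinite products over primes are in increasing order; $(\frac\cdot p)$ is the Legendre symbol. (HL): for all $a,b,c\in\mathbb{Z}$ with $a>0$, $b^2-4ac$ not a square, $\gcd(a,b,c)=1$, and $a+b$, $c$ not both even, the number $\pi_{a,b,c}(x)$ of primes $p\leqslant x$ of the form $am^2+bm+c$, $m\in\mathbb{Z}_{\geqslant1}$, satisfies $\pi_{a,b,c}(x)\sim\frac{\gcd(2,a+b)}{\sqrt a}\frac{\Delta}{\varphi(\Delta)}\prod_{p\nmid2a}\Big(1-\frac{(\frac{b^2-4ac}{p})}{p-1}\Big)\frac{\sqrt x}{\log x}$, $\Delta$ being the odd part of $\gcd(a,b)$. *)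

(* Defs.v *)
From HB Require Import structures.
From mathcomp Require Import all_boot all_order all_algebra all_field.
From mathcomp Require Import finmap.
From mathcomp Require Import all_classical all_reals all_analysis.

Set Implicit Arguments.
Unset Strict Implicit.
Unset Printing Implicit Defensive.

Import Order.TTheory GRing.Theory Num.Theory.
Import numFieldNormedType.Exports.

Local Open Scope classical_set_scope.
Local Open Scope ring_scope.

Definition legendre (d : int) (p : nat) : int :=
  if (p%:Z %| d)%Z then 0
  else if [exists m : 'I_p, (p%:Z %| (m : nat)%:Z ^+ 2 - d)%Z] then 1
  else -1.

Definition odd_part (n : nat) : nat := (n`_(2^'))%N.

(* The infinite product, over the primes p not dividing m in increasing order,
   of 1 - (d/p)/(p-1).  It is only conditionally convergent, so it is the limit
   of the products over the primes p < N. *)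
Definition HL_product (R : realType) (d : int) (m : nat) : R :=
  lim ((\prod_(0 <= p < N | prime p && ~~ (p %| m)%N)
          (1 - (legendre d p)%:~R / (p%:R - 1)) : R) @[N --> \oo]).

(* The relation f(x) ~ C sqrt(x) / log x as x -> +oo, with the convention that
   for C = 0 it means f(x) = O(1). *)
Definition asymp_sqrt_log (R : realType) (f : R -> R) (C : R) : Prop :=
  (C = 0 -> bounded_near f +oo) /\
  (C != 0 -> f x / (C * (Num.sqrt x / ln x)) @[x --> +oo] --> (1 : R)).

(* Cardinals of (finite) sets are given by fset_set, which is the empty set on
   infinite ones.  The sets below are finite: they are bounded in norm, resp.
   made of primes bounded by x. *)
Definition quad_prime_count (R : realType) (a b c : int) (x : R) : nat :=
  #|` fset_set [set p : nat | [/\ prime p, p%:R <= x &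
        exists2 m : nat, (0 < m)%N &
          p%:Z = a * m%:Z ^+ 2 + b * m%:Z + c]] |.

Definition HL_constant (R : realType) (a b c : int) : R :=
  let Delta := odd_part `|gcdz a b|%N in
  (gcdz 2 (a + b))%:~R / Num.sqrt a%:~R *
  (Delta%:R / (totient Delta)%:R) *
  HL_product R (b ^+ 2 - 4 * a * c) `|(2 * a)%R|%N.

Definition HardyLittlewood (R : realType) : Prop :=
  forall a b c : int,
    0 < a ->
    ~ (exists s : int, b ^+ 2 - 4 * a * c = s ^+ 2) ->
    gcdz (gcdz a b) c = 1 ->
    ~ ((2 %| a + b)%Z /\ (2 %| c)%Z) ->
    asymp_sqrt_log (fun x : R => (quad_prime_count a b c x)%:R)
                   (HL_constant R a b c).

(* Q(sqrt(-D)) is realized inside the algebraic numbers, where its nontrivial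
   automorphism is the complex conjugation. *)
Definition imag_quad_field (D : nat) : set algC :=
  [set z | exists u v : rat, z = ratr u + ratr v * sqrtC (- D%:R)].

Definition imag_quad_int (D : nat) : set algC :=
  [set z | imag_quad_field D z /\ z \in Aint].

Definition quad_norm (z : algC) : algC := z * z^*.
Definition quad_trace (z : algC) : algC := z + z^*.

Definition Pi_set (R : realType) (D : nat) (x : R) : set algC :=
  [set z | imag_quad_int D z /\
     exists p : nat, [/\ prime p, p%:R <= x & quad_norm z = p%:R]].

Definition Pi_count (R : realType) (D : nat) (r : int) (q : nat) (a : int)
    (x : R) : nat :=
  #|` fset_set [set z | [/\ Pi_set D x z, quad_trace z = r%:~R &
        (quad_norm z == a%:~R %[mod q%:R])%C]] |.

Definition theta (D : nat) (r : int) : nat :=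
  [|| (D == 2%N) && (r == 2 %[mod 4])%Z,
      [&& D == 3 %[mod 4], (2 %| r)%Z & gcdz D%:Z r == 1]
    | [&& D == 3 %[mod 8], ~~ (2 %| r)%Z & gcdz D%:Z r == 1]].

(* r^2/4 is an integer only for even r; theta 2 r = 0 for odd r. *)
Definition varrho (r : int) (q : nat) (a : int) : nat :=
  #|[pred t : 'I_q |
      (2 * (t : nat)%:Z ^+ 2 + (r ^+ 2 %/ 4)%Z == a %[mod q%:Z])%Z]|.

(* To be used for D congruent to 3 modulo 4 only, so that 4 divides D + 1. *)
Definition varrhoD (D : nat) (r : int) (q : nat) (a : int) : nat :=
  #|[pred t : 'I_q |
      (D%:Z * (t : nat)%:Z ^+ 2 - D%:Z * r * (t : nat)%:Z
         + (D.+1 %/ 4)%N%:Z * r ^+ 2 == a %[mod q%:Z])%Z]|.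

(* Main.v *)
Require Import Defs.
From HB Require Import structures.
From mathcomp Require Import all_boot all_order all_algebra all_field.
From mathcomp Require Import finmap.
From mathcomp Require Import all_classical all_reals all_analysis.
From mathcomp Require Import ring lra zify.

(* An integer of trace r in Q(sqrt(-D)) is (r + (2 s + b) sqrt(-D)) / 2 with s an
   integer, where b = 0 if D = 2 and b = -r if D > 2; its norm is a quadratic
   polynomial N(s) with leading coefficient D and discriminant -D r^2.  The
   condition on N(s) mod q selects residues t of s mod q, and for each of them
   m |-> N(t + q m) and m |-> N(t - q m) are forms to which (HL) applies.  Their
   (HL) constants do not depend on t or the sign: the discriminants are all
   -D q^2 r^2, and Delta has the same odd prime divisors as D q.  Summing over the
   2 rho forms gives the result, up to O(1) for the s in [0, q) and for the finitely
   many coincidences N(s) = N(s').  When theta = 0, the norm can only be one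
   fixed prime, 2 or D.  The products over primes agree factor by factor, so
   their convergence plays no role. *)

Set Implicit Arguments.
Unset Strict Implicit.
Unset Printing Implicit Defensive.

Import Order.TTheory GRing.Theory Num.Theory.
Import numFieldNormedType.Exports.

Local Open Scope classical_set_scope.
Local Open Scope ring_scope.

(** * Legendre symbols, totient ratios and the product over primes *)

(** [legendre] searches roots in [0, p) only; reduction mod p extends the search to all integers,
    where roots can be multiplied freely. *)
Lemma legendre_ext (d d' : int) (p : nat) :
  (p%:Z %| d)%Z = (p%:Z %| d')%Z ->
  ((exists m : int, (p%:Z %| m ^+ 2 - d)%Z) <->
   (exists m : int, (p%:Z %| m ^+ 2 - d')%Z)) ->
  prime p -> legendre d p = legendre d' p.
Proof.
move=> ddvd sq p_pr; have p_gt0 := prime_gt0 p_pr.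
have residue e : [exists m : 'I_p, (p%:Z %| (m : nat)%:Z ^+ 2 - e)%Z] <->
    exists m : int, (p%:Z %| m ^+ 2 - e)%Z.
  split=> [/existsP[m hm]|[m hm]]; first by exists m%:Z.
  have m_ge0 : 0 <= (m %% p%:Z)%Z by rewrite modz_ge0 // -lt0n.
  have m_lt : (`|(m %% p%:Z)%Z|%N < p)%N.
    by rewrite -ltz_nat gez0_abs // ltz_pmod // ltz_nat.
  apply/existsP; exists (Ordinal m_lt); rewrite /= gez0_abs //.
  have -> : (m %% p)%Z ^+ 2 - e = m ^+ 2 - e
      - p%:Z * ((m %/ p)%Z * (m + (m %% p)%Z)).
    by move: (m %/ p)%Z (m %% p)%Z (divz_eq m p%:Z) => ? ? ->; ring.
  by rewrite rpredB ?dvdz_mulr.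
rewrite /legendre ddvd; case: ifP => // _.
suff -> : [exists m : 'I_p, (p%:Z %| (m : nat)%:Z ^+ 2 - d)%Z] =
  [exists m : 'I_p, (p%:Z %| (m : nat)%:Z ^+ 2 - d')%Z] by [].
by apply/idP/idP => /residue/sq/residue.
Qed.

(** Multiplication by k carries a root for d to one for d k^2; an inverse v of k mod p, from Bezout,
    carries it back. *)
Lemma legendre_mul_sqr (d k : int) (p : nat) :
  prime p -> ~~ (p%:Z %| k)%Z -> legendre (d * k ^+ 2) p = legendre d p.
Proof.
move=> p_pr pk.
have cop : coprimez p%:Z k by rewrite coprimezE /= prime_coprime.
have cop2 : coprimez p%:Z (k ^+ 2) by rewrite expr2 coprimezMr cop.
apply: legendre_ext => //.
  by rewrite mulrC Gauss_dvdzr.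
have [u [v uv]] := Bezoutz p%:Z k.
split=> -[m hm].
- exists (m * v); rewrite -(Gauss_dvdzr _ cop2).
  have -> : k ^+ 2 * ((m * v) ^+ 2 - d) = (m ^+ 2 - d * k ^+ 2) * (k * v) ^+ 2
      + (d * k ^+ 2) * ((k * v) ^+ 2 - 1) by ring.
  apply: rpredD; [exact: dvdz_mulr|apply: dvdz_mull].
  have -> : (k * v) ^+ 2 - 1 = p%:Z * (- u * (k * v + 1)).
    have := eqP cop; rewrite -uv => e; have -> : k * v = 1 - u * p%:Z by rewrite -e; ring.
    ring.
  exact: dvdz_mulr.
- exists (m * k).
  have -> : (m * k) ^+ 2 - d * k ^+ 2 = (m ^+ 2 - d) * k ^+ 2 by ring.
  by rewrite dvdz_mulr.
Qed.

Lemma odd_part_gt0 n : (0 < odd_part n)%N.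
Proof. exact: part_gt0. Qed.

Lemma primes_odd_part n m : (0 < n)%N -> (0 < m)%N ->
  (forall p, prime p -> odd p -> (p %| n)%N = (p %| m)%N) ->
  primes (odd_part n) = primes (odd_part m).
Proof.
move=> n_gt0 m_gt0 nm.
rewrite /odd_part !primes_part; apply: (irr_sorted_eq ltn_trans ltnn).
- by rewrite sorted_filter ?sorted_primes //; exact: ltn_trans.
- by rewrite sorted_filter ?sorted_primes //; exact: ltn_trans.
move=> p; rewrite !mem_filter !mem_primes n_gt0 m_gt0 /=.
have [p_pr|] := boolP (prime p); rewrite ?andbF //=.
rewrite !inE /=; have [//|p2] := eqVneq p 2%N; rewrite nm //.
by case: (even_prime p_pr) p2 => [->|].
Qed.

(** In each factor p^(e+1) / ((p - 1) p^e) the powers cancel. So n / phi(n) depends only on the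
    primes dividing n. *)
Lemma ratio_totient (R : numFieldType) n : (0 < n)%N ->
  n%:R / (totient n)%:R = \prod_(p <- primes n) (p%:R / p.-1%:R) :> R.
Proof.
move=> n_gt0; rewrite totientE // {1}(prod_prime_decomp n_gt0).
rewrite prime_decompE big_map /= !natr_prod -prodf_div.
rewrite [LHS]big_seq [RHS]big_seq; apply: eq_bigr => p.
rewrite mem_primes => /and3P[p_pr _ pn].
have : (0 < logn p n)%N by rewrite logn_gt0 mem_primes p_pr n_gt0.
case: (logn p n) => // e _ /=; rewrite expnS !natrM.
have p0 : (p ^ e)%:R != 0 :> R by rewrite pnatr_eq0 -lt0n expn_gt0 prime_gt0.
by rewrite -mulf_div mulfV // mulr1.
Qed.

(** An excluded prime contributes the factor 1, as if its symbol were 0; products with different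
    exclusions thus become comparable. *)
Lemma HL_product_ext (R : realType) (d d' : int) (m m' : nat) :
  (forall p, prime p -> (if (p %| m)%N then 0 else legendre d p) =
                        (if (p %| m')%N then 0 else legendre d' p)) ->
  HL_product R d m = HL_product R d' m'.
Proof.
move=> eqL; rewrite /HL_product.
suff -> : (fun N => \prod_(0 <= p < N | prime p && ~~ (p %| m)%N)
                      (1 - (legendre d p)%:~R / (p%:R - 1)) : R) =
          (fun N => \prod_(0 <= p < N | prime p && ~~ (p %| m')%N)
                      (1 - (legendre d' p)%:~R / (p%:R - 1))) by [].
have term e k N : \prod_(0 <= p < N | prime p && ~~ (p %| k)%N)
          (1 - (legendre e p)%:~R / (p%:R - 1)) =
    \prod_(0 <= p < N | prime p)
     (1 - (if (p %| k)%N then 0 else legendre e p)%:~R / (p%:R - 1)) :> R.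
  rewrite big_mkcondr; apply: eq_bigr => p _.
  by case: ifP => pk; rewrite ?(negbTE pk) // (negbFE pk) mul0r subr0.
apply/funext => N; rewrite !term.
by apply: eq_bigr => p /eqL ->.
Qed.

(** Let p be odd and prime to q. If p | r, the left symbol is 0 or excluded and p is excluded on the
    right; if p | D only, the roles are exchanged. Otherwise the symbols differ by the square (q
    r)^2. *)
Lemma HL_product_form (R : realType) (D q r : int) :
  HL_product R (- D * q ^+ 2 * r ^+ 2) `|(2 * (D * q ^+ 2))%R|%N =
  HL_product R (- D) `|(2 * q * r)%R|%N.
Proof.
apply: HL_product_ext => p p_pr.
have Ep (k : int) : (p %| `|k|)%N = (p%:Z %| k)%Z by [].
have pM (x y : int) : (p%:Z %| x * y)%Z = (p%:Z %| x)%Z || (p%:Z %| y)%Z.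
  by rewrite !dvdzE abszM Euclid_dvdM.
have pX (x : int) : (p%:Z %| x ^+ 2)%Z = (p%:Z %| x)%Z.
  by rewrite expr2 pM orbb.
rewrite !Ep !pM ?orbb.
have [//|p2] := boolP (p%:Z %| 2)%Z.
have [/=|pq] := boolP (p%:Z %| q)%Z; first by rewrite orbT.
have [/=|pr] := boolP (p%:Z %| r)%Z => /=.
  by rewrite orbF /legendre !pM ?orbb => ->; rewrite orbT if_same.
rewrite orbF !legendre_mul_sqr //; case: ifP => // pD.
by rewrite /legendre /= rpredN pD.
Qed.

(** * Calculus of the relation [asymp_sqrt_log] *)

Lemma asymp_sqrt_log0 (R : realType) (f : R -> R) (C K : R) :
  (forall x, `|f x| <= K) -> C = 0 -> asymp_sqrt_log f C.
Proof.
move=> fK ->; split; last by rewrite eqxx.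
move=> _; exists K; split=> [|M KM]; first exact: num_real.
near=> x; exact: le_trans (fK x) (ltW KM).
Unshelve. all: by end_near.
Qed.

Lemma bounded_near_dist (R : realType) (f g : R -> R) (K : R) :
  bounded_near f +oo -> (forall x, `|f x - g x| <= K) -> bounded_near g +oo.
Proof.
(* [bounded_near] provides the bounds strictly above M, whence M + 1. *)
move=> [M [Mreal fM]] fgK; exists (M + 1 + K); split=> [|N MN]; first exact: num_real.
have {}fM := fM (M + 1) _.
near=> x => /=.
have -> : g x = f x - (f x - g x) by rewrite subKr.
apply: le_trans (ler_normB _ _) _.
apply: le_trans (lerD _ (fgK x)) (ltW MN).
near: x; apply: fM; rewrite ltrDl; exact: ltr01.
Unshelve. all: by end_near.
Qed.

(** With y = x^(1/4), ln x = 4 ln y <= 4 y and sqrt x = y^2, so the quotient is at most 4 / y, hence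
    at most e once x >= (4 / e)^4. *)
Lemma ln_div_sqrt_cvg0 (R : realType) :
  (ln x / Num.sqrt x : R) @[x --> +oo] --> (0 : R).
Proof.
apply/cvgrPdist_le => e e0; near=> x.
have x0 : 0 < x by near: x; exact: nbhs_pinfty_gt.
have x1 : 1 <= x by near: x; exact: nbhs_pinfty_ge.
have xe : (e^-1 * 4) ^+ 2 ^+ 2 <= x.
  by near: x; apply: nbhs_pinfty_ge; rewrite num_real.
pose y := Num.sqrt (Num.sqrt x).
have y0 : 0 < y by rewrite !sqrtr_gt0.
have yy : Num.sqrt x = y ^+ 2 by rewrite sqr_sqrtr // sqrtr_ge0.
have lnx : ln x <= 4 * y.
  have -> : x = y ^+ 4 by rewrite (exprM y 2 2) -yy sqr_sqrtr // ltW.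
  rewrite lnXn // -[leLHS]mulr_natl ler_wpM2l //; exact/ltW/ln_sublinear.
rewrite sub0r normrN ger0_norm; last by rewrite divr_ge0 ?ln_ge0 ?sqrtr_ge0.
rewrite yy ler_pdivrMr ?exprn_gt0 //; apply: le_trans lnx _.
rewrite expr2 mulrA ler_wpM2r ?(ltW y0) // -ler_pdivrMl //.
rewrite /y -[leLHS]ger0_norm -?sqrtr_sqr; last by rewrite mulr_ge0 ?invr_ge0 ?(ltW e0).
rewrite ler_sqrt ?sqrtr_ge0 // -[leLHS]ger0_norm -?sqrtr_sqr ?sqr_ge0 //.
by rewrite ler_sqrt ?(ltW x0).
Unshelve. all: by end_near.
Qed.

(** An O(1) error divided by C sqrt x / ln x is squeezed to 0; for C = 0 it preserves
    boundedness. *)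
Lemma asymp_sqrt_log_dist (R : realType) (f g : R -> R) (C K : R) :
  asymp_sqrt_log f C -> (forall x, `|f x - g x| <= K) -> asymp_sqrt_log g C.
Proof.
move=> [f0 f1] fgK; split=> [/f0 bf|Cn0]; first exact: bounded_near_dist bf fgK.
have {}f1 := f1 Cn0.
have K0 : 0 <= K by apply: le_trans (fgK 0).
have err : ((f x - g x) / (C * (Num.sqrt x / ln x))) @[x --> +oo] --> (0 : R).
  apply: (@squeeze_cvgr _ _ _ _
    (fun x => - (K / `|C| * (ln x / Num.sqrt x)))
    (fun x => K / `|C| * (ln x / Num.sqrt x))).
  - near=> x.
    rewrite -ler_norml normrM normfV normrM.
    have x1 : 1 <= x by near: x; exact: nbhs_pinfty_ge.
    have sl0 : 0 <= Num.sqrt x / ln x by rewrite divr_ge0 ?sqrtr_ge0 ?ln_ge0.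
    rewrite (ger0_norm sl0).
    rewrite invfM invf_div [leLHS]mulrA.
    by rewrite ler_wpM2r ?divr_ge0 ?sqrtr_ge0 ?ln_ge0 //
       ler_wpM2r ?invr_ge0.
  - rewrite -[X in _ --> X]oppr0 -(mulr0 (K / `|C|)).
    apply: cvgN; apply: cvgMr; exact: ln_div_sqrt_cvg0.
  - rewrite -[X in _ --> X](mulr0 (K / `|C|)).
    apply: cvgMr; exact: ln_div_sqrt_cvg0.
rewrite -[X in _ --> X]subr0.
apply: cvg_trans (cvgB f1 err); apply: near_eq_cvg; near=> x => /=.
by rewrite -mulrBl subKr.
Unshelve. all: by end_near.
Qed.

Lemma bounded_near_sum (R : realType) (I : Type) (s : seq I) (P : pred I)
    (f : I -> R -> R) :
  (forall i, P i -> bounded_near (f i) +oo) ->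
  bounded_near (fun x => \sum_(i <- s | P i) f i x) +oo.
Proof.
move=> bf; elim: s => [|i s IH].
  by exists 0; split=> [|M M0]; [exact: num_real|near=> x; rewrite /= big_nil normr0 ltW].
have [Pi|nPi] := boolP (P i); last first.
  by under eq_fun do rewrite big_cons (negbTE nPi).
under eq_fun do rewrite big_cons Pi.
have /ex_bound[M fM] := bf i Pi; have /ex_bound[N sN] := IH.
apply/ex_bound; exists (M + N); near=> x; apply: le_trans (ler_normD _ _) _.
by apply: lerD; near: x.
Unshelve. all: by end_near.
Qed.

(** The total constant vanishes if P is empty (the sum is 0) or if C = 0 (a sum of bounded
    functions). Otherwise the average of the quotients tends to 1. *)
Lemma asymp_sqrt_log_sum (R : realType) (I : finType) (P : pred I)
    (f : I -> R -> R) (C : R) :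
  (forall i, P i -> asymp_sqrt_log (f i) C) ->
  asymp_sqrt_log (fun x => \sum_(i | P i) f i x) (#|P|%:R * C).
Proof.
move=> fC; split=> [/eqP|].
  rewrite mulf_eq0 pnatr_eq0 => /orP[/eqP /card0_eq P0|/eqP C0].
    exists 0; split=> [|M M0]; first exact: num_real.
    by near=> x; rewrite /= big_pred0 // normr0 ltW.
  have {}fC i : P i -> bounded_near (f i) +oo by case/fC => + _; apply.
  exact: bounded_near_sum.
rewrite mulf_eq0 negb_or pnatr_eq0 => /andP[P0 C0].
have P0' : (#|P|%:R : R) != 0 by rewrite pnatr_eq0.
have {}fC i : P i -> f i x / (C * (Num.sqrt x / ln x)) @[x --> +oo] --> (1 : R).
  by case/fC => _; apply.
have : (\sum_(i | P i) (f i x / (C * (Num.sqrt x / ln x)))) / #|P|%:R @[x --> +oo] -->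
  (\sum_(i | P i) 1 : R) / #|P|%:R.
  apply: cvgMl.
  by apply: cvg_big => [|i]; [exact: add_continuous|exact: fC].
rewrite sumr_const divff //; apply: cvg_trans; apply: near_eq_cvg; near=> x.
by rewrite -mulr_suml -mulrA -invfM; congr (_ / _); rewrite mulrC mulrA.
Unshelve. all: by end_near.
Qed.

(** * Cardinals of finite sets *)

Lemma fset_set_leq (T : choiceType) (A B : set T) :
  finite_set B -> A `<=` B -> (#|` fset_set A| <= #|` fset_set B|)%N.
Proof.
move=> finB AB; apply: fsubset_leq_card; rewrite -fset_set_sub //.
exact: sub_finite_set finB.
Qed.

(** F minus E embeds into the image, and the rest of F lies in E. *)
Lemma card_imfset_near (T U : choiceType) (h : T -> U) (F E : {fset T}) :
  {in [pred x | (x \in F) && (x \notin E)] &, injective h} ->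
  (#|` F| <= #|` (h @` F)%fset| + #|` E|)%N.
Proof.
move=> hinj.
rewrite -(cardfsID E F) addnC leq_add //; last first.
  by apply: fsubset_leq_card; exact: fsubsetIr.
have <- : #|` (h @` (F `\` E))%fset| = #|` (F `\` E)%fset|.
  apply: card_in_imfset => x y; rewrite !inE => /andP[xE xF] /andP[yE yF].
  by apply: hinj; rewrite inE ?xF ?yF.
apply: fsubset_leq_card; apply/fsubsetP => _ /imfsetP[x /= + ->].
by rewrite inE => /andP[_ xF]; apply: in_imfset.
Qed.

Lemma finite_int_ball (n : nat) : finite_set [set s : int | (`|s| <= n)%N].
Proof.
apply: (@sub_finite_set _ _ ((fun k : nat => k%:Z - n%:Z) @` `I_((n + n).+1))).
  move=> s /= sn; exists `|(s + n%:Z)%R|%N => /=; lia.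
exact/finite_image/finite_II.
Qed.

(** * The norm form and its prime values *)

(* With 4 C = r^2 + D b^2, this is the norm of (r + (2 s + b) sqrt(-D)) / 2. *)
Definition norm_form (D b C s : int) : int := D * s ^+ 2 + D * b * s + C.

(** With B = |b| + 1, this rests on |s|^2 - B |s| + B^2 >= 0 and D >= 1. It confines the arguments
    of bounded values to a finite set. *)
Lemma norm_form_ge (D b C s : int) : 0 < D ->
  `|s| <= norm_form D b C s + (D * (`|b| + 1) ^+ 2 + `|C|).
Proof.
move=> D0; rewrite /norm_form.
have sq : `|s| <= s ^+ 2 + b * s + (`|b| + 1) ^+ 2.
  have : - (`|b| * `|s|) <= b * s by rewrite -normrM lerNnormlW.
  have -> : s ^+ 2 = `|s| ^+ 2 by rewrite real_normK ?num_real.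
  have := normr_ge0 b; have := normr_ge0 s; nra.
have : - `|C| <= C by rewrite lerNnormlW.
have -> : D * s ^+ 2 + D * b * s + C + (D * (`|b| + 1) ^+ 2 + `|C|) =
    D * (s ^+ 2 + b * s + (`|b| + 1) ^+ 2) + (C + `|C|) by ring.
move=> C0; apply: (le_trans sq); apply: (@le_trans _ _
    (D * (s ^+ 2 + b * s + (`|b| + 1) ^+ 2))); last by rewrite lerDl -lerBlDr sub0r.
by rewrite ler_peMl // (le_trans _ sq).
Qed.

(** The difference of the two values is D (s - s') (s + s' + b). *)
Lemma norm_form_inj (D b C s s' : int) : D != 0 ->
  norm_form D b C s = norm_form D b C s' -> s = s' \/ s + s' = - b.
Proof.
move=> D0 e; have : D * ((s - s') * (s + s' + b)) = 0.
  by have := subrr (norm_form D b C s); rewrite {2}e /norm_form => <-; ring.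
move/eqP; rewrite mulf_eq0 (negbTE D0) mulf_eq0 subr_eq0 addr_eq0 /=.
by case/orP => /eqP; [left|right].
Qed.

Lemma norm_form_mod (D b C q s t : int) : (s == t %[mod q])%Z ->
  (norm_form D b C s == norm_form D b C t %[mod q])%Z.
Proof.
rewrite !eqz_mod_dvd => st.
have -> : norm_form D b C s - norm_form D b C t = (s - t) * (D * (s + t + b)).
  by rewrite /norm_form; ring.
exact: dvdz_mulr.
Qed.

(** Arguments are collected rather than primes, because conjugate elements share trace and norm but
    count separately in [Pi_count]. *)
Definition norm_prime_args (R : realType) (D b C : int) (q : nat) (a : int)
    (x : R) : set int :=
  [set s | exists p : nat, [/\ prime p, p%:R <= x, p%:Z = norm_form D b C s
                           & (p%:Z == a %[mod q%:Z])%Z]].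

Lemma finite_norm_prime_args (R : realType) (D b C : int) (q : nat) (a : int)
  (x : R) : 0 < D -> finite_set (norm_prime_args D b C q a x).
Proof.
move=> D0.
apply: (@sub_finite_set _ _
  [set s : int | (`|s| <= (Num.truncn x + `|(D * (`|b| + 1) ^+ 2 + `|C|)%R|)%N)%N]);
  last exact: finite_int_ball.
move=> s [p [_ px ps _]] /=.
have pt : (p <= Num.truncn x)%N.
  by rewrite truncn_ge_nat // (le_trans _ px).
have := norm_form_ge b C s D0; rewrite -ps; lia.
Qed.

(** * Sorting the arguments by residue and sign *)

Definition norm_residues (D b C : int) (q : nat) (a : int) : pred 'I_q :=
  [pred t : 'I_q | (norm_form D b C (t : nat)%:Z == a %[mod q%:Z])%Z].

(* The arguments s = t + q m (second component true) or s = t - q m (false)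
   with m >= 1: these classes cover all integers outside [0, q). *)
Definition half_class (q : nat) (i : 'I_q * bool) : pred int :=
  [pred s | (s == (i.1 : nat)%:Z %[mod q%:Z])%Z
            && (if i.2 then q%:Z <= s else s < 0)].

Lemma half_classP (q : nat) (i : 'I_q * bool) (s : int) :
  reflect (exists2 m : nat, (0 < m)%N &
             s = (i.1 : nat)%:Z + (-1) ^+ (~~ i.2) * (q%:Z * m%:Z))
          (half_class i s).
Proof.
case: i => t e /=; have tq := ltn_ord t; have t0 := leq0n t.
apply: (iffP andP) => /= [[]|[m m0 ->]].
  rewrite eqz_mod_dvd => /dvdzP[k sk].
  have -> : s = (t : nat)%:Z + k * q%:Z by rewrite -sk subrKC.
  (* As 0 <= t < q, the conditions q <= s and s < 0 mean k >= 1 and k <= -1. *)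
  case: e => hs; exists `|k|%N; rewrite ?expr0 ?expr1 ?mul1r ?mulN1r; nia.
split.
  by rewrite eqz_mod_dvd addrC addKr dvdz_mull ?dvdz_mulr.
case: e => /=; rewrite ?expr0 ?expr1 ?mul1r ?mulN1r; nia.
Qed.

(* norm_form can take the same value at s and s' <> s only if s + s' = -b;
   within one half class s and s' have the same sign, so this forces
   |s| <= |b|. *)
Lemma quad_prime_count_half_class (R : realType) (D b C : int) (q : nat)
    (a : int) (i : 'I_q * bool) (x : R) :
  0 < D -> norm_residues D b C a i.1 ->
  let n := #|` [fset s in fset_set (norm_prime_args D b C q a x)
               | half_class i s]%fset| in
  let m := quad_prime_count (D * q%:Z ^+ 2)
       ((-1) ^+ (~~ i.2) * (D * q%:Z * (2 * (i.1 : nat)%:Z + b)))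
       (norm_form D b C (i.1 : nat)%:Z) x in
  (m <= n)%N /\ (n <= m + #|` fset_set [set s : int | (`|s| <= `|b|)%N]|)%N.
Proof.
move=> D0 ti n m; have fS := finite_norm_prime_args b C q a x D0.
pose A := [fset s in fset_set (norm_prime_args D b C q a x) | half_class i s]%fset.
have AE s : (s \in A) = (s \in norm_prime_args D b C q a x) && half_class i s.
  by rewrite !inE in_fset_set.
have formE m' : D * q%:Z ^+ 2 * m' ^+ 2 + (-1) ^+ (~~ i.2) *
      (D * q%:Z * (2 * (i.1 : nat)%:Z + b)) * m' + norm_form D b C (i.1 : nat)%:Z =
    norm_form D b C ((i.1 : nat)%:Z + (-1) ^+ (~~ i.2) * (q%:Z * m')).
  by rewrite /norm_form; case: i.2; rewrite ?expr0 ?expr1; ring.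
(* [m] counts primes, [A] arguments: [m] is the number of distinct values of the norm form on
   [A]. *)
have mE : m = #|` ((absz \o norm_form D b C) @` A)%fset|.
  rewrite /m /quad_prime_count -(set_fsetK A) -fset_set_image //.
  congr (#|` fset_set _|); apply/seteqP; split=> p /=.
    move=> [p_pr px [m' m'0]]; rewrite formE => pE.
    exists ((i.1 : nat)%:Z + (-1) ^+ (~~ i.2) * (q%:Z * m'%:Z)); last by rewrite /= -pE.
    rewrite /= AE; apply/andP; split; last by apply/half_classP; exists m'.
    apply: mem_set; exists p; split=> //; rewrite pE -(eqP ti).
    by apply: norm_form_mod; rewrite eqz_mod_dvd addrC addKr dvdz_mull ?dvdz_mulr.
  move=> [s + <-]; rewrite /= AE.
  move=> /andP[/set_mem[p' [p'_pr p'x p's _]] /half_classP[m' m'0 sE]].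
  rewrite -p's /=; split=> //; exists m' => //.
  by rewrite p's formE -sE.
rewrite mE; split; first exact: leq_imfset_card.
rewrite -/A; apply: card_imfset_near => s s'.
rewrite ![_ \in [pred _ | _]]unfold_in /= !AE !(in_fset_set (finite_int_ball _)).
move=> /andP[/andP[/set_mem[p [_ _ pE _]] hs] sE].
move=> /andP[/andP[/set_mem[p' [_ _ p'E _]] hs'] s'E].
rewrite /= -pE -p'E /= => pp'; move: p'E; rewrite -pp' pE => e.
have [//|] := norm_form_inj (lt0r_neq0 D0) e.
have {}sE : (`|b| < `|s|)%N by rewrite ltnNge; apply: contra sE => ?; exact: mem_set.
move: hs hs' => /andP[_ hs] /andP[_ hs']; case: (i.2) hs hs'; lia.
Qed.

Lemma sum_fset_card (T : choiceType) (F : {fset T}) (p : pred T) :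
  #|` [fset s in F | p s]%fset| = (\sum_(s <- F) p s)%N.
Proof.
rewrite card_fset_sum1 -big_fset_condE big_mkcond /=.
by apply: eq_bigr => s _; case: (p s).
Qed.

(** Only the class of the residue of s, with the sign decided by q <= s, can contain s, and it fails
    to do so exactly for s in [0, q). The hypothesis puts this residue among those summed over. *)
Lemma half_class_sum (q : nat) (P : pred 'I_q) (s : int) : (0 < q)%N ->
  (forall t : 'I_q, (s == (t : nat)%:Z %[mod q%:Z])%Z -> P t) ->
  (\sum_(i : 'I_q * bool | P i.1) half_class i s = ~~ (0 <= s < q%:Z)%R)%N.
Proof.
move=> q0 sP; have q0' : q%:Z != 0 by lia.
have s_lt : (`|(s %% q%:Z)%Z|%N < q)%N.
  by rewrite -ltz_nat gez0_abs ?modz_ge0 // ltz_pmod.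
pose t := Ordinal s_lt.
have tE : (t : nat)%:Z = (s %% q%:Z)%Z by rewrite /= gez0_abs ?modz_ge0.
have st : (s == (t : nat)%:Z %[mod q%:Z])%Z by rewrite tE modz_mod.
have uniq_t (t' : 'I_q) : (s == (t' : nat)%:Z %[mod q%:Z])%Z = (t' == t).
  apply/idP/eqP => [|->//]; rewrite (modz_small (m := (t' : nat)%:Z));
    last by rewrite ltz_nat ltn_ord.
  by rewrite -tE eqz_nat => /eqP/val_inj ->.
rewrite (bigD1 (t, q%:Z <= s)) /=; last exact: sP.
rewrite big1 ?addn0 => [|[t' e] /= /andP[_ /negP ne]].
  by rewrite /half_class /= st /=; case: ifP; lia.
rewrite /half_class /= uniq_t; case: eqP => //= tt'.
apply/eqP; rewrite eqb0; apply/negP => hs; apply: ne.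
rewrite tt' xpair_eqE eqxx /=; case: e hs => [->//|s0].
by apply/eqP/esym/negbTE; lia.
Qed.

Lemma quad_prime_count_sum (R : realType) (D b C : int) (q : nat) (a : int) :
  0 < D -> (0 < q)%N ->
  exists K : R, forall x : R,
   `| \sum_(i : 'I_q * bool | norm_residues D b C a i.1)
       (quad_prime_count (D * q%:Z ^+ 2)
         ((-1) ^+ (~~ i.2) * (D * q%:Z * (2 * (i.1 : nat)%:Z + b)))
         (norm_form D b C (i.1 : nat)%:Z) x)%:R
     - (#|` fset_set (norm_prime_args D b C q a x)|)%:R | <= K.
Proof.
move=> D0 q0.
(* [K1] bounds the coincidences within one half class, [K2] the arguments in [0, q). *)
pose K1 := #|` fset_set [set s : int | (`|s| <= `|b|)%N]|.
pose K2 := #|` fset_set [set s : int | (`|s| <= q)%N]|.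
exists (#|{: 'I_q * bool}| * K1 + K2)%:R => x.
set F := fset_set _; have fS := finite_norm_prime_args b C q a x D0.
(* Exchanging the sums, each argument is counted once, either in [0, q) or in its half class. *)
have -> : #|` F| = (#|` [fset s in F | (0 <= s < q%:Z)%R]%fset| +
   \sum_(i : 'I_q * bool | norm_residues D b C a i.1)
      #|` [fset s in F | half_class i s]%fset|)%N.
  under eq_bigr do rewrite sum_fset_card.
  rewrite exchange_big sum_fset_card -big_split /= card_fset_sum1.
  rewrite big_seq [RHS]big_seq; apply: eq_bigr => s.
  rewrite in_fset_set // => /set_mem[p [_ _ pE pa]].
  rewrite half_class_sum //; first by case: (_ && _).
  by move=> t st; rewrite /norm_residues /= -(eqP pa) pE eq_sym norm_form_mod.
rewrite -natr_sum.
set M := (\sum_(i | _) _)%N; set N := (\sum_(i | _) _)%N.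
have MN : (M <= N)%N.
  by apply: leq_sum => i /(quad_prime_count_half_class x D0)[].
have NM : (N <= M + #|{: 'I_q * bool}| * K1)%N.
  apply: (@leq_trans (\sum_(i : 'I_q * bool | norm_residues D b C a i.1)
    (quad_prime_count (D * q%:Z ^+ 2)
         ((-1) ^+ (~~ i.2) * (D * q%:Z * (2 * (i.1 : nat)%:Z + b)))
         (norm_form D b C (i.1 : nat)%:Z) x + K1)))%N.
    by apply: leq_sum => i /(quad_prime_count_half_class x D0)[].
  rewrite big_split /= leq_add2l sum_nat_const leq_mul2r max_card orbT //.
have EK : (#|` [fset s in F | (0 <= s < q%:Z)%R]%fset| <= K2)%N.
  apply: fsubset_leq_card; apply/fsubsetP => s; rewrite !inE => /andP[_ sq].
  rewrite in_fset_set; last exact: finite_int_ball.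
  by apply: mem_set => /=; lia.
rewrite distrC ger0_norm; last by rewrite subr_ge0 ler_nat (leq_trans MN) ?leq_addl.
by rewrite lerBlDr -natrD ler_nat; lia.
Qed.

(** * Elements of given trace and prime norm *)

(** For w^2 = -n, the product of w and its conjugate is |w^2| = n = -w^2; cancel w. *)
Lemma conj_sqrtC_neg (n : nat) : (sqrtC (- n%:R))^* = - sqrtC (- n%:R) :> algC.
Proof.
set w := sqrtC _; have ww : w ^+ 2 = - n%:R by rewrite /w sqrtCK.
have [w0|w0] := eqVneq w 0; first by rewrite w0 rmorph0 oppr0.
apply: (mulfI w0); rewrite -normCK -normrX ww normrN normr_nat mulrN -expr2 ww.
by rewrite opprK.
Qed.

(** z is a root of the monic polynomial X^2 - Tr(z) X + N(z). *)
Lemma Aint_conj_pair (z : algC) :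
  z + z^* \in Num.int -> z * z^* \in Num.int -> z \in Aint.
Proof.
move=> tz nz.
apply: (@root_monic_Aint (('X - z%:P) * ('X - (z^*)%:P))).
- by rewrite rootM root_XsubC eqxx.
- by rewrite monicMl ?monicXsubC.
have -> : ('X - z%:P) * ('X - (z^*)%:P) =
    'X ^+ 2 - (z + z^*)%:P * 'X + (z * z^*)%:P.
  by rewrite polyCD polyCM; ring.
apply/polyOverP => i; rewrite coefD coefB coefXn coefMX !coefC.
by case: i => [|[|[|i]]] //=; rewrite ?subr0 ?sub0r ?addr0 ?add0r ?rpredN ?rpred0 ?rpred1.
Qed.

(** The squared denominator of v is coprime to the numerator, so it divides D, which is
    squarefree. *)
Lemma rat_int_of_prime_mul_sqr (D : nat) (v : rat) (k : int) :
  prime D -> D%:R * v ^+ 2 = k%:~R -> exists n : int, v = n%:~R.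
Proof.
move=> D_pr e.
have d0 : (denq v)%:~R != 0 :> rat by rewrite intr_eq0 denq_neq0.
have e' : D%:Z * numq v ^+ 2 = k * denq v ^+ 2.
  move: e; rewrite -{1}(divq_num_den v) expr_div_n mulrA.
  move=> /(canRL (divfK (expf_neq0 2 d0))) e; apply: (@intr_inj rat).
  by rewrite !expr2 !rmorphM /= -!expr2.
have dD : (`|denq v| ^ 2 %| D)%N.
  have cop : coprime (`|denq v| ^ 2) (`|numq v| ^ 2).
    by rewrite coprimeXl ?coprimeXr // coprime_sym coprime_num_den.
  rewrite -(Gauss_dvdl _ cop) -!abszX -(abszM D%:Z) e' abszM abszX.
  exact: dvdn_mull.
have d1 : `|denq v|%N = 1%N.
  have dvd1 : (`|denq v| %| D)%N by apply: dvdn_trans dD; rewrite dvdn_exp.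
  have := prime_gt1 D_pr; move: dD.
  case/primeP: D_pr => _ /(_ _ dvd1) /orP[/eqP //|/eqP ->].
  by move=> /dvdn_leq; nia.
exists (numq v); rewrite -[LHS]divq_num_den.
have -> : denq v = 1 by have := denq_gt0 v; lia.
by rewrite divr1.
Qed.

(** Integrality is not built in: it will follow from r^2 + D w^2 = 4 p, which also settles the
    parity of w. *)
Definition half_point (D : nat) (r w : int) : algC :=
  (r%:~R + w%:~R * sqrtC (- D%:R)) / 2.

Lemma half_point_conj D r w :
  (half_point D r w)^* = (r%:~R - w%:~R * sqrtC (- D%:R)) / 2.
Proof.
rewrite /half_point rmorphM rmorphD rmorphM /= conj_sqrtC_neg fmorphV.
by rewrite !rmorph_int rmorph_nat mulrN.
Qed.

Lemma half_point_trace D r w : quad_trace (half_point D r w) = r%:~R.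
Proof. by rewrite /quad_trace half_point_conj /half_point; field. Qed.

Lemma half_point_norm D r w :
  quad_norm (half_point D r w) = (r ^+ 2 + D%:Z * w ^+ 2)%:~R / 4.
Proof.
rewrite /quad_norm half_point_conj /half_point rmorphD rmorphM !rmorphXn /=.
have -> : (D%:~R : algC) = - sqrtC (- D%:R) ^+ 2 by rewrite sqrtCK opprK.
by field.
Qed.

Lemma half_point_inj D r : (0 < D)%N -> injective (half_point D r).
Proof.
move=> D0 w w' /(mulIf _) e.
have : (w%:~R * sqrtC (- D%:R) : algC) = w'%:~R * sqrtC (- D%:R).
  by apply: (addrI (r%:~R)); apply: e; rewrite invr_eq0 pnatr_eq0.
move/mulIf => /(_ _)/intr_inj; apply.
by rewrite sqrtC_eq0 oppr_eq0 pnatr_eq0 -lt0n.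
Qed.

Lemma eqCmod_intr (q : nat) (m n : int) :
  (m%:~R == n%:~R %[mod q%:R])%C = (m == n %[mod q%:Z])%Z.
Proof. by rewrite eqz_mod_dvd /eqCmod -rmorphB /= dvdC_int ?intr_int // intrKfloor. Qed.

(** For z = u + v sqrt(-D), trace and norm give 2 u = r and D (2 v)^2 = 4 p - r^2, so w = 2 v is an
    integer. Conversely, integral trace and norm make z an algebraic integer. *)
Lemma Pi_count_halfP (R : realType) (D : nat) (r : int) (q : nat) (a : int)
    (x : R) (z : algC) : prime D ->
  [/\ Pi_set D x z, quad_trace z = r%:~R &
        (quad_norm z == a%:~R %[mod q%:R])%C] <->
  exists w : int, exists p : nat,
    [/\ prime p, p%:R <= x, r ^+ 2 + D%:Z * w ^+ 2 = 4 * p%:Z,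
        (p%:Z == a %[mod q%:Z])%Z & z = half_point D r w].
Proof.
move=> D_pr; split.
  case=> -[[[u [v zE]] _] [p [p_pr px zp]]] tz nz.
  have cz : z^* = ratr u - ratr v * sqrtC (- D%:R).
    have := conj_Crat (Crat_rat v); have := conj_Crat (Crat_rat u); rewrite zE.
    move: (ratr u) (ratr v) => U V UE VE.
    by rewrite rmorphD rmorphM /= UE VE conj_sqrtC_neg mulrN.
  have uE : u * 2 = r%:~R.
    apply: (@fmorph_inj _ _ (@ratr algC)); rewrite rmorph_int -tz.
    by rewrite /quad_trace cz zE rmorphM /= ratr_nat; ring.
  have vE : D%:R * (v * 2) ^+ 2 = 4 * p%:R - r%:~R ^+ 2.
    apply: (@fmorph_inj _ _ (@ratr algC)).
    rewrite rmorphM rmorphXn rmorphM rmorphB rmorphM rmorphXn /=.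
    rewrite !rmorph_nat rmorph_int -zp -tz /quad_trace /quad_norm cz zE.
    have := sqrtCK (- D%:R : algC); move: (sqrtC _) => w /eqP.
    by rewrite eq_sym eqr_oppLR => /eqP ->; ring.
  have vE' : D%:R * (v * 2) ^+ 2 = (4 * p%:Z - r ^+ 2)%:~R.
    by rewrite vE rmorphB rmorphM /= rmorphXn.
  have [w wE] := rat_int_of_prime_mul_sqr D_pr vE'.
  exists w, p; split=> //.
  - apply: (@intr_inj rat); move: vE; rewrite wE => vE.
    by rewrite rmorphD rmorphXn rmorphM rmorphXn rmorphM /= vE subrKC.
  - by move: nz; rewrite zp -eqCmod_intr.
  - rewrite /half_point.
    have -> : (r%:~R : algC) = ratr u * 2 by rewrite -ratr_int -uE rmorphM /= ratr_nat.
    have -> : (w%:~R : algC) = ratr v * 2 by rewrite -ratr_int -wE rmorphM /= ratr_nat.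
    by rewrite zE; field.
move=> [w [p [p_pr px wp pa ->]]].
have nE : quad_norm (half_point D r w) = p%:R.
  by rewrite half_point_norm wp rmorphM /= -[p%:~R]/(p%:R); field.
split; [|exact: half_point_trace|by rewrite nE -[p%:R]/(p%:Z%:~R) eqCmod_intr].
split; last by exists p.
split.
  exists (r%:~R / 2), (w%:~R / 2).
  rewrite !rmorphM /= !fmorphV /= !ratr_int !ratr_nat /half_point; by field.
apply: Aint_conj_pair.
  by rewrite -[_ + _]/(quad_trace _) half_point_trace.
by rewrite -[_ * _]/(quad_norm _) nE.
Qed.

Lemma norm_form_four (D b C r s : int) : 4 * C = r ^+ 2 + D * b ^+ 2 ->
  4 * norm_form D b C s = r ^+ 2 + D * (2 * s + b) ^+ 2.
Proof.
move=> C4; have -> : 4 * norm_form D b C s = 4 * D * s ^+ 2 + 4 * D * b * s + 4 * C.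
  by rewrite /norm_form; ring.
by rewrite C4; ring.
Qed.

(** The parity hypothesis makes every w of the form 2 s + b, so that s parametrizes the elements
    bijectively. *)
Lemma Pi_countE (R : realType) (D : nat) (b C r : int) (q : nat) (a : int)
    (x : R) : prime D -> 4 * C = r ^+ 2 + D%:Z * b ^+ 2 ->
  (forall w p : int, r ^+ 2 + D%:Z * w ^+ 2 = 4 * p -> (2 %| w - b)%Z) ->
  Pi_count D r q a x = #|` fset_set (norm_prime_args D%:Z b C q a x)|.
Proof.
move=> D_pr C4 par; have D0 := prime_gt0 D_pr.
pose h s := half_point D r (2 * s + b).
have h_inj : injective h.
  by move=> s s' /(half_point_inj D0)/addIr; apply: mulfI.
have fS : finite_set (norm_prime_args D%:Z b C q a x).
  by apply: finite_norm_prime_args; rewrite ltz_nat.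
have <- : #|` (h @` fset_set (norm_prime_args D%:Z b C q a x))%fset| =
    #|` fset_set (norm_prime_args D%:Z b C q a x)| by exact: card_imfset.
rewrite -fset_set_image //.
rewrite /Pi_count; congr (#|` fset_set _|); apply/seteqP; split=> z /=.
  move=> /(Pi_count_halfP _ _ _ _ _ D_pr)[w [p [p_pr px wp pa ->]]].
  have /dvdzP[s ws] := par _ _ wp.
  have wE : w = 2 * s + b by rewrite -(subrK b w) ws mulrC.
  exists s; last by rewrite /h wE.
  exists p; split=> //; apply: (@mulfI _ 4) => //.
  by rewrite (norm_form_four s C4) -wp wE.
move=> [s [p [p_pr px ps pa]] <-]; apply/Pi_count_halfP => //.
by exists (2 * s + b), p; split=> //; rewrite ps (norm_form_four s C4).
Qed.

(** Bounded norms give w^2 <= D w^2 <= 4 B, so all elements lie in one finite set independent of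
    x. *)
Lemma Pi_count_bounded (R : realType) (D : nat) (r : int) (q : nat) (a : int)
    (B : nat) : prime D ->
  (forall (w : int) (p : nat), prime p -> r ^+ 2 + D%:Z * w ^+ 2 = 4 * p%:Z ->
     (p <= B)%N) ->
  exists K : R, forall x : R, `|(Pi_count D r q a x)%:R : R| <= K.
Proof.
move=> D_pr pB; have D0 := prime_gt0 D_pr.
pose S := half_point D r @` [set w : int | (`|w| <= 4 * B)%N].
exists (#|` fset_set S|)%:R => x; rewrite normr_nat ler_nat.
apply: fset_set_leq; first exact/finite_image/finite_int_ball.
move=> z /(Pi_count_halfP _ _ _ _ _ D_pr)[w [p [p_pr px wp pa ->]]].
exists w => //=; have {}pB := pB _ _ p_pr wp.
have r0 := sqr_ge0 r; have : w ^+ 2 <= D%:Z * w ^+ 2 by rewrite ler_peMl ?sqr_ge0.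
have : `|w| <= w ^+ 2.
  have [->|w0] := eqVneq w 0; first by [].
  by rewrite -[leRHS]ger0_norm ?sqr_ge0 // normrX ler_eXnr //; lia.
lia.
Qed.

(** * The Hardy--Littlewood conjecture for the half class forms *)

(** The norm form has discriminant D^2 b^2 - 4 D C = -D r^2; the substitution s = t + e q m
    multiplies it by q^2. *)
Lemma class_form_disc (D b C r q t e : int) :
  4 * C = r ^+ 2 + D * b ^+ 2 -> e ^+ 2 = 1 ->
  (e * (D * q * (2 * t + b))) ^+ 2 - 4 * (D * q ^+ 2) * norm_form D b C t =
  - D * q ^+ 2 * r ^+ 2.
Proof.
move=> C4 e1; have rE : r ^+ 2 = 4 * C - D * b ^+ 2 by rewrite C4 addrK.
have -> : (e * (D * q * (2 * t + b))) ^+ 2 =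
   e ^+ 2 * (D * q * (2 * t + b)) ^+ 2 by ring.
by rewrite e1 rE /norm_form; ring.
Qed.

(** Mod 2 the sign e and the term 2 t disappear, so gcd(2, .) is the same for all classes. *)
Lemma class_form_parity (D b q t e : int) : e ^+ 2 = 1 ->
  exists k : int,
    D * q ^+ 2 + e * (D * q * (2 * t + b)) = k * 2 + D * q * (q + b).
Proof.
move=> e1; have : (e == 1) || (e == -1) by rewrite -eqf_sqr e1 expr1n.
by case/orP => /eqP ->; [exists (D * q * t)|exists (- (D * q * (t + b)))]; ring.
Qed.

(** A prime dividing D q^2 divides D q, and D q divides both D q^2 and D q (2 t + b). So [Delta] and
    the odd part of D q have the same primes, hence the same totient ratio. *)
Lemma HL_constant_class (R : realType) (D b C r : int) (q : nat) (t e : int) :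
  0 < D -> (0 < q)%N -> 4 * C = r ^+ 2 + D * b ^+ 2 -> e ^+ 2 = 1 ->
  HL_constant R (D * q%:Z ^+ 2) (e * (D * q%:Z * (2 * t + b)))
      (norm_form D b C t) =
  (gcdz 2 (D * q%:Z * (q%:Z + b)))%:~R / (Num.sqrt D%:~R * q%:R) *
  ((odd_part (`|D| * q))%:R / (totient (odd_part (`|D| * q)))%:R) *
  HL_product R (- D) `|(2 * q%:Z * r)%R|%N.
Proof.
move=> D0 q0 C4 e1; rewrite /HL_constant.
rewrite (class_form_disc _ _ C4 e1).
rewrite HL_product_form; congr (_ * _ * _).
  congr (_%:~R / _).
    by have [k ->] := class_form_parity D b q t e1; rewrite gcdzMDl.
  by rewrite intrM sqrtrM ?ler0z ?ltW // rmorphXn sqrtr_sqr normr_nat.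
have g0 : (0 < `|gcdz (D * q%:Z ^+ 2) (e * (D * q%:Z * (2 * t + b)))|)%N.
  by rewrite absz_gt0 gcdz_eq0; nia.
have Dq0 : (0 < `|D| * q)%N by rewrite muln_gt0 absz_gt0 gt_eqF.
rewrite !ratio_totient ?odd_part_gt0 //; congr (bigop.body _ _ _).
apply: primes_odd_part => // p p_pr _.
rewrite -[(p %| _)%N]/(p%:Z %| gcdz _ _)%Z dvdz_gcd.
apply/andP/idP => [[+ _]|].
  by rewrite !dvdzE !abszM !Euclid_dvdM //= => /orP[->|/orP[]->]; rewrite ?orbT.
move=> pDq; have : (p%:Z %| D * q%:Z)%Z by rewrite dvdzE abszM.
move=> pDqz; split; first by rewrite expr2 mulrA dvdz_mulr.
by rewrite mulrCA dvdz_mulr.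
Qed.

Lemma asymp_norm_prime_args (R : realType) (D b C r : int) (q : nat) (a : int) :
  HardyLittlewood R -> 0 < D -> r != 0 -> (0 < q)%N -> gcdz q%:Z a = 1 ->
  4 * C = r ^+ 2 + D * b ^+ 2 -> coprimez D C ->
  (forall t, (2 %| D * q%:Z * (q%:Z + b))%Z ->
     (norm_form D b C t == a %[mod q%:Z])%Z -> ~ (2 %| norm_form D b C t)%Z) ->
  asymp_sqrt_log (fun x : R => (#|` fset_set (norm_prime_args D b C q a x)|)%:R)
    ((2 * #|@norm_residues D b C q a|)%:R *
     ((gcdz 2 (D * q%:Z * (q%:Z + b)))%:~R / (Num.sqrt D%:~R * q%:R) *
  ((odd_part (`|D| * q))%:R / (totient (odd_part (`|D| * q)))%:R) *
  HL_product R (- D) `|(2 * q%:Z * r)%R|%N)).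
Proof.
move=> HL D0 r0 q0 qa C4 DC par; have [K KP] := quad_prime_count_sum R b C a D0 q0.
apply: (asymp_sqrt_log_dist _ KP).
(* Each admissible residue gives two forms, one per sign. *)
have -> : (2 * #|@norm_residues D b C q a|)%N =
    #|[pred i : 'I_q * bool | norm_residues D b C a i.1]|.
  rewrite mulnC -card_bool -cardX; apply: eq_card => -[t e].
  by rewrite !inE andbT.
apply: asymp_sqrt_log_sum => -[t e] /= ti.
have e1 : (-1) ^+ (~~ e) ^+ 2 = 1 :> int by rewrite sqrr_sign.
rewrite -(HL_constant_class R t D0 q0 C4 e1).
have q0' : 0 < q%:Z by rewrite ltz_nat.
apply: HL.
- by rewrite mulr_gt0 // exprn_gt0.
(* The discriminant -D q^2 r^2 is negative, as r is nonzero. *)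
- move=> [s]; rewrite (class_form_disc _ _ C4 e1) => sE.
  have : 0 <= s ^+ 2 by exact: sqr_ge0.
  have pos : 0 < D * q%:Z ^+ 2 * r ^+ 2.
    apply: mulr_gt0; last by rewrite exprn_even_gt0.
    exact: mulr_gt0 D0 (exprn_gt0 2 q0').
  by rewrite -sE !mulNr oppr_ge0 leNgt pos.
(* N(t) is C mod D and a mod q, hence coprime to D q^2: the form is primitive. *)
- have cop : coprimez (D * q%:Z ^+ 2) (norm_form D b C (t : nat)%:Z).
    rewrite coprimezMl; apply/andP; split.
      have -> : norm_form D b C (t : nat)%:Z =
          ((t : nat)%:Z ^+ 2 + b * (t : nat)%:Z) * D + C by rewrite /norm_form; ring.
      by rewrite /coprimez gcdzMDl.
    apply: coprimezXl; rewrite /coprimez -gcdz_modr (eqP ti) gcdz_modr.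
    exact/eqP.
  apply/eqP; apply: coprimez_dvdl cop; exact: dvdz_gcdl.
- have [k ->] := class_form_parity D b q t e1 => -[par1 par2].
  apply: par ti par2; move: par1.
  by rewrite rpredDl // dvdz_mull.
Qed.

(** * Parity, and the norms possible when [theta] vanishes *)

Lemma odd_partM (m n : nat) : (0 < m)%N -> (0 < n)%N ->
  odd_part (m * n) = (odd_part m * odd_part n)%N.
Proof. by move=> m0 n0; rewrite /odd_part partnM. Qed.

Lemma odd_part_odd (n : nat) : odd n -> odd_part n = n.
Proof. by move=> n_odd; rewrite /odd_part part_pnat_id // -odd_2'nat. Qed.

Lemma even_mulz (m n : int) : (2 %| m * n)%Z = (2 %| m)%Z || (2 %| n)%Z.
Proof. by rewrite !dvdzE abszM Euclid_dvdM. Qed.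

Lemma even_sqrz (m : int) : (2 %| m ^+ 2)%Z = (2 %| m)%Z.
Proof. by rewrite expr2 even_mulz orbb. Qed.

Lemma even_prime_int (p : nat) : prime p -> (2 %| p%:Z)%Z -> p = 2%N.
Proof. by move=> p_pr; rewrite dvdzE /= dvdn_prime2 // => /eqP. Qed.

(** Mod 2 the equation reads (w + r)^2 = 0. *)
Lemma sqr_add_parity (D r w p : int) : ~~ (2 %| D)%Z ->
  r ^+ 2 + D * w ^+ 2 = 4 * p -> (2 %| w + r)%Z.
Proof.
move=> D_odd e; have [k Dk] : exists k, D = 2 * k + 1 by exists (D %/ 2)%Z; lia.
rewrite -even_sqrz; apply/dvdzP; exists (2 * p - k * w ^+ 2 + r * w).
have -> : (2 * p - k * w ^+ 2 + r * w) * 2 = 4 * p - 2 * k * w ^+ 2 + 2 * r * w by ring.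
by rewrite -e Dk; ring.
Qed.

(** The equation makes r even, so r = 4 k; then w = 2 v is even and p = 4 k^2 + 2 v^2. *)
Lemma norm_prime_two (r w : int) (p : nat) : prime p -> ~~ (r == 2 %[mod 4])%Z ->
  r ^+ 2 + 2 * w ^+ 2 = 4 * p%:Z -> p = 2%N.
Proof.
move=> p_pr r4 e; have r_even : (2 %| r)%Z.
  by rewrite -even_sqrz; apply/dvdzP; exists (2 * p%:Z - w ^+ 2); lia.
have [k rk] : exists k, r = 4 * k by exists (r %/ 4)%Z; lia.
move: e; rewrite rk => e.
have /dvdzP[v wv] : (2 %| w)%Z.
  by rewrite -even_sqrz; apply/dvdzP; exists (p%:Z - 4 * k ^+ 2); lia.
by apply: even_prime_int => //; apply/dvdzP; exists (2 * k ^+ 2 + v ^+ 2); lia.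
Qed.

(** Both r and w are odd, with squares 1 mod 8, so 4 p is 1 + 7 = 0 mod 8 and p is even. *)
Lemma norm_prime_seven (r w : int) (p : nat) : prime p -> ~~ (2 %| r)%Z ->
  r ^+ 2 + 7 * w ^+ 2 = 4 * p%:Z -> p = 2%N.
Proof.
move=> p_pr r_odd e; have wr : (2 %| w + r)%Z by apply: sqr_add_parity e.
have [k rk] : exists k, r = 2 * k + 1 by exists (r %/ 2)%Z; lia.
have [j wj] : exists j, w = 2 * j + 1 by exists (w %/ 2)%Z; lia.
have kk : (2 %| k * (k + 1))%Z by rewrite even_mulz; lia.
have jj : (2 %| j * (j + 1))%Z by rewrite even_mulz; lia.
apply: even_prime_int => //.
have -> : p%:Z = k * (k + 1) + 7 * (j * (j + 1)) + 2 by move: e; rewrite rk wj; lia.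
by apply: rpredD => //; apply: rpredD => //; exact: dvdz_mull.
Qed.

(** * The two asymptotic formulas *)

Theorem theorem6p9 (R : realType) (HL : HardyLittlewood R)
    (D : nat) (hD : D \in [:: 2; 3; 7; 11; 19; 43; 67; 163]%N)
    (r : int) (hr : r != 0)
    (q : nat) (hq : (1 <= q)%N) (a : int) (hqa : gcdz q%:Z a = 1) :
  (D = 2%N ->
     asymp_sqrt_log (fun x : R => (Pi_count D r q a x)%:R)
       ((theta D r)%:R * (varrho r q a)%:R *
        (2 * Num.sqrt 2 / q%:R) *
        ((odd_part q)%:R / (totient (odd_part q))%:R) *
        HL_product R (- 2) `|(2 * q%:Z * r)%R|%N))
  /\
  ((2 < D)%N ->
     asymp_sqrt_log (fun x : R => (Pi_count D r q a x)%:R)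
       ((theta D r)%:R * (varrhoD D r q a)%:R *
        (2 * (gcdz 2 (q%:Z * (r + 1)))%:~R / q%:R) *
        (Num.sqrt D%:R * (odd_part q)%:R / (totient (D * odd_part q))%:R) *
        HL_product R (- D%:Z) `|(2 * q%:Z * r)%R|%N)).
Proof.
split=> [D2|D2].
- subst D; have [r4|r4] := boolP (r == 2 %[mod 4])%Z; last first.
    have th0 : theta 2 r = 0%N by rewrite /theta (negbTE r4).
    have [//|w p p_pr /(norm_prime_two p_pr r4) ->|K KP] :=
      @Pi_count_bounded R 2 r q a 2; first by [].
    by apply: asymp_sqrt_log0 KP _; rewrite th0 !mul0r.
  have th1 : theta 2 r = 1%N by rewrite /theta r4.
  have /dvdzP[k rk] : (4 %| r - 2)%Z by rewrite -eqz_mod_dvd.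
  (* For D = 2, take b = 0 and C = (r / 2)^2, which is odd. *)
  have rE : r = 2 * (2 * k + 1) by rewrite -(subrK 2 r) rk; ring.
  set C := (2 * k + 1) ^+ 2.
  have C4 : 4 * C = r ^+ 2 + 2 * 0 ^+ 2 by rewrite rE /C; ring.
  have CE : (r ^+ 2 %/ 4)%Z = C.
    by rewrite rE (_ : _ ^+ 2 = C * 4) ?mulzK // /C; ring.
  have C_odd : ~~ (2 %| C)%Z by rewrite even_sqrz; lia.
  have -> : (fun x : R => (Pi_count 2 r q a x)%:R : R) =
      fun x => (#|` fset_set (norm_prime_args 2 0 C q a x)|)%:R.
    apply/funext => x; rewrite (Pi_countE _ _ _ _ C4) // => w p wp.
    (* Dividing 4 C + 2 w^2 = 4 p by 2 gives w^2 = 2 (p - C), so w is even. *)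
    rewrite subr0 -even_sqrz; apply/dvdzP; exists (p - C).
    by move: wp; rewrite rE /C; lia.
  have cop : coprimez 2 C by rewrite coprimezE prime_coprime.
  have := @asymp_norm_prime_args R 2 0 C r q a HL isT hr hq hqa C4 cop.
  have -> : gcdz 2 (2 * q%:Z * (q%:Z + 0)) = 2.
    by rewrite -mulrA; apply/gcdz_idPl; exact: dvdz_mulr.
  have -> : #|@norm_residues 2 0 C q a| = varrho r q a.
    apply: eq_card => t; rewrite !inE CE /norm_form.
    by congr (_ %% _ == _)%Z; ring.
  rewrite odd_partM // [odd_part 2](_ : _ = 1%N) ?mul1n; last first.
    by rewrite /odd_part; apply: part_p'nat.
  set P := HL_product _ _ _; set T := _ / (totient _)%:R; rewrite th1.
  have S0 : Num.sqrt 2 != 0 :> R by rewrite gt_eqF // sqrtr_gt0.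
  have SS : Num.sqrt 2 ^+ 2 = 2 :> R by rewrite sqr_sqrtr.
  have q0 : q%:R != 0 :> R by rewrite pnatr_eq0 -lt0n.
  (* Two signs and the gcd 2 give 4 / sqrt 2 = 2 sqrt 2. *)
  have -> : (2 * varrho r q a)%:R * (2%:~R / (Num.sqrt 2%:~R * q%:R) * T * P) =
      1%:R * (varrho r q a)%:R * (2 * Num.sqrt 2 / q%:R) * T * P :> R.
    rewrite natrM -[2%:~R]/(2%:R : R).
    by move: (Num.sqrt _) S0 SS => S S0 <-; field; rewrite q0.
  apply => t _ _; have -> : norm_form 2 0 C t = 2 * t ^+ 2 + C.
    by rewrite /norm_form; ring.
  move=> Nt; move/negP: C_odd; apply; rewrite -(addKr (2 * t ^+ 2) C).
  by apply: rpredD Nt; rewrite rpredN; exact: dvdz_mulr.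
have [D_pr D4] : prime D /\ (D %% 4 = 3)%N.
  by move: hD D2; rewrite !inE; do 7?[case/orP]; move=> /eqP->.
have D_odd : odd D by lia.
have [th|th] := boolP ((gcdz D%:Z r == 1) && ((2 %| r)%Z || (D %% 8 == 3)%N)); last first.
  have th0 : theta D r = 0%N.
    apply/eqP; rewrite eqb0; apply: contra th; rewrite gtn_eqF //=.
    by case/orP => /and3P[]; [move=> _ -> ->|move=> -> _ ->; rewrite orbT].
  (* The norm can only be 2 or D, and 163 is the largest D. *)
  have [//|w p p_pr e|K KP] := @Pi_count_bounded R D r q a 163; last first.
    by apply: asymp_sqrt_log0 KP _; rewrite th0 !mul0r.
  have D163 : (D <= 163)%N.
    by move: hD; rewrite !inE; do 7?[case/orP]; move=> /eqP->.
  (* If D | r, then D | 4 p with D odd, so p = D. *)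
  have [Dr|Dr] := boolP (D%:Z %| r)%Z.
    have : (D%:Z %| (2 * 2) * p%:Z)%Z.
      by rewrite -[2 * 2]/(4 : int) -e rpredD // ?dvdz_mulr // expr2 dvdz_mulr.
    rewrite dvdzE !abszM !Euclid_dvdM //= !dvdn_prime2 //.
    by move=> /orP[/orP[]|] /eqP; lia.
  have cop : gcdz D%:Z r == 1.
    by rewrite -/(coprimez _ _) coprimezE prime_coprime // -dvdzE.
  move: th; rewrite cop /= negb_or => /andP[r_odd D8].
  (* Among the listed D > 2, only 7 is not 3 mod 8. *)
  have D7 : D = 7%N.
    by move: hD D2 D8; rewrite !inE; do 7?[case/orP]; move=> /eqP->.
  by move: e; rewrite D7 => /(norm_prime_seven p_pr r_odd) ->.
have th1 : theta D r = 1%N.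
  move: th; rewrite /theta => /andP[-> /orP[->|/eqP D8]].
    by rewrite (_ : D == 3 %[mod 4]) ?orbT // D4.
  rewrite (_ : D == 3 %[mod 4]) ?D4 // (_ : D == 3 %[mod 8]) ?D8 //.
  by case: (2 %| r)%Z; rewrite /= ?orbT.
have {th} [/eqP cop rD] := andP th.
(* Here b = -r, and 4 C = (D + 1) r^2 gives C = n r^2 with n = (D + 1) / 4; D = 4 n - 1 is coprime
   to n. *)
set n := (D.+1 %/ 4)%N; have nD : (D = 4 * n - 1)%N by rewrite /n; lia.
have nDz : D%:Z = 4 * n%:Z - 1 by rewrite /n; lia.
set C := n%:Z * r ^+ 2.
have C4 : 4 * C = r ^+ 2 + D%:Z * (- r) ^+ 2 by rewrite nDz /C; ring.
have Dpar : ~~ (2 %| D%:Z)%Z by lia.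
have -> : (fun x : R => (Pi_count D r q a x)%:R : R) =
    fun x => (#|` fset_set (norm_prime_args D%:Z (- r) C q a x)|)%:R.
  apply/funext => x; rewrite (Pi_countE _ _ _ _ C4) // => w p wp.
  by rewrite opprK; exact: sqr_add_parity wp.
have copC : coprimez D%:Z C.
  rewrite coprimezMr; apply/andP; split; last by apply: coprimezXr; exact/eqP.
  by rewrite coprimez_sym /coprimez nDz gcdzMDl gcdzN gcdz1.
have D0 : 0 < D%:Z by lia.
have := @asymp_norm_prime_args R D%:Z (- r) C r q a HL D0 hr hq hqa C4 copC.
have -> : gcdz 2 (D%:Z * q%:Z * (q%:Z + - r)) = gcdz 2 (q%:Z * (r + 1)).
  have [d Dd] : exists d, D%:Z = 2 * d + 1 by exists (D%:Z %/ 2)%Z; lia.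
  (* Mod 2, D = 1 and q^2 = q, so D q (q - r) becomes q (r + 1). *)
  have /dvdzP[k qk] : (2 %| q%:Z * (q%:Z - 1))%Z by rewrite even_mulz; lia.
  have -> : D%:Z * q%:Z * (q%:Z + - r) =
    (q%:Z * (d * (q%:Z - r) - r) + k) * 2 + q%:Z * (r + 1).
    by rewrite [RHS]addrC mulrDl -qk Dd; ring.
  by rewrite gcdzMDl.
have -> : #|@norm_residues D%:Z (- r) C q a| = varrhoD D r q a.
  apply: eq_card => t; rewrite !inE /norm_form -/n.
  by congr (_ %% _ == _)%Z; rewrite /C; ring.
have -> : odd_part (`|D%:Z| * q) = (D * odd_part q)%N.
  by rewrite absz_nat odd_partM ?(prime_gt0 D_pr) // (odd_part_odd D_odd).
set P := HL_product _ _ _; set T := totient _; rewrite th1.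
have S0 : Num.sqrt D%:R != 0 :> R by rewrite gt_eqF // sqrtr_gt0 ltr0n prime_gt0.
have SS : D%:R = Num.sqrt D%:R ^+ 2 :> R by rewrite sqr_sqrtr.
have q0 : q%:R != 0 :> R by rewrite pnatr_eq0 -lt0n.
have T0 : T%:R != 0 :> R.
  by rewrite pnatr_eq0 -lt0n totient_gt0 muln_gt0 prime_gt0 // odd_part_gt0.
set g := (gcdz _ _)%:~R.
(* The factor sqrt D arises as D / sqrt D. *)
have -> : (2 * varrhoD D r q a)%:R * (g / (Num.sqrt D%:Z%:~R * q%:R) *
      ((D * odd_part q)%:R / T%:R) * P) =
   1%:R * (varrhoD D r q a)%:R * (2 * g / q%:R) *
   (Num.sqrt D%:R * (odd_part q)%:R / T%:R) * P :> R.
  rewrite !natrM -[D%:Z%:~R]/(D%:R : R) [in X in X / T%:R]SS.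
  by move: (Num.sqrt _) S0 {SS} => S S0; field; rewrite S0 q0 T0.
apply => t par ta Nt_even.
(* For even q, an even N(t) congruent to a mod q would make a even, against gcd(q, a) = 1. *)
have [q_even|q_odd] := boolP (2 %| q%:Z)%Z.
  have : (2 %| gcdz q%:Z a)%Z.
    rewrite dvdz_gcd q_even /=; move: ta; rewrite eqz_mod_dvd => ta.
    have -> : a = norm_form D%:Z (- r) C t - (norm_form D%:Z (- r) C t - a).
      by rewrite subKr.
    by rewrite rpredB // (dvdz_trans q_even).
  by rewrite hqa.
(* For odd q, q - r is even, so r is odd and [theta] forces D = 3 mod 8. Then n and C are odd, t (t
   - r) is even, and N(t) is odd. *)
move: par; rewrite !even_mulz (negbTE Dpar) (negbTE q_odd) /= => qr.
have r_odd : ~~ (2 %| r)%Z by lia.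
move: rD; rewrite (negbTE r_odd) /= => /eqP D8.
have C_odd : ~~ (2 %| C)%Z by rewrite even_mulz even_sqrz negb_or r_odd andbT /n; lia.
move: Nt_even; have -> : norm_form D%:Z (- r) C t = D%:Z * (t * (t - r)) + C.
  by rewrite /norm_form; ring.
rewrite rpredDl ?(negbTE C_odd) //; apply: dvdz_mull.
by rewrite even_mulz; lia.
Qed.
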